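(* Let $p_1,p_2,q$ be real numbers with $1\le p_1\le q<\infty$ and $1\le p_2\le q<\infty$. If the inclusion $w\ell^{p_2}_q\subseteq\ell^{p_1}_q$ holds and is proper (i.e. $w\ell^{p_2}_q\subseteq\ell^{p_1}_q$ and $\ell^{p_1}_q\setminus w\ell^{p_2}_q\neq\emptyset$), then $p_1<p_2$.
   Context: For $m\in\mathbb{Z}$ and $N\in\mathbb{N}_0=\mathbb{N}\cup\{0\}$ let $S_{m,N}:=\{m-N,\ldots,m,\ldots,m+N\}\subset\mathbb{Z}$, so $|S_{m,N}|=2N+1$. For $1\le p\le q<\infty$, the discrete Morrey space $\ell^p_q=\ell^p_q(\mathbb{Z})$ is the set of all scalar sequences $x=(x_j)_{j\in\mathbb{Z}}$ such that $$\|x\|_{\ell^p_q}:=\sup_{m\in\mathbb{Z},\,N\in\mathbb{N}_0}|S_{m,N}|^{\frac1q-\frac1p}\Big(\sum_{j\in S_{m,N}}|x_j|^p\Big)^{\frac1p}<\infty.$$ The weak type discrete Morrey space $w\ell^p_q$ is the set of all scalar sequences $x=(x_j)_{j\in\mathbb{Z}}$ for which the quasi-norm $$\|x\|_{w\ell^p_q}:=\sup_{m\in\mathbb{Z},\,N\in\mathbb{N}_0,\,\gamma>0}\gamma\,|S_{m,N}|^{\frac1q-\frac1p}\,\big|\{j\in S_{m,N}:|x_j|>\gamma\}\big|^{\frac1p}$$ is finite, where $|A|$ denotes the cardinality of a finite set $A$. *)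

(* Defs.v *)
From HB Require Import structures.
From mathcomp Require Import all_boot all_order all_algebra finmap.
From mathcomp Require Import all_classical all_reals all_analysis.
From mathcomp Require Import complex zify.
Set Implicit Arguments.
Unset Strict Implicit.
Unset Printing Implicit Defensive.
Import Order.TTheory GRing.Theory Num.Theory.
Local Open Scope classical_set_scope.
Local Open Scope fset_scope.
Local Open Scope ring_scope.

(* The two scalar fields. [Rcomplex R] is R[i] with the R-valued modulus,
   whereas the norm of [R[i]] itself takes its values in R[i]. *)
Variant scalar_kind := RealScalars | ComplexScalars.

Definition scalars (R : realType) (k : scalar_kind) : normedZmodType R :=
  match k with
  | RealScalars => R : normedZmodType R
  | ComplexScalars => Rcomplex R : normedZmodType R
  end.

Definition window (m : int) (N : nat) : {fset int} :=
  [fset m - N%:Z + i%:Z | i in iota 0 N.*2.+1].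

Lemma in_window (m : int) (N : nat) (j : int) :
  (j \in window m N) = (m - N%:Z <= j <= m + N%:Z).
Proof.
apply/imfsetP/idP => [[i /= + ->]|jmN].
  by rewrite ?inE mem_iota; lia.
exists (absz (j - (m - N%:Z))%R) => /=; last by lia.
by rewrite ?inE mem_iota; lia.
Qed.

Lemma card_window (m : int) (N : nat) : #|` window m N| = N.*2.+1.
Proof.
rewrite /window card_imfset /= => [|i j /addrI[]//].
by rewrite undup_id ?iota_uniq // mem_iota /= size_iota.
Qed.

Section spaces.
Variables (R : realType) (K : normedZmodType R).
Implicit Types (p q : R) (x : int -> K).

Definition morrey_norm p q x : \bar R :=
  ereal_sup [set ((#|` window mN.1 mN.2|%:R `^ (q^-1 - p^-1)
                   * (\sum_(j <- window mN.1 mN.2) `|x j| `^ p) `^ p^-1)%:E)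
            | mN in [set: int * nat]].

Definition weak_morrey_norm p q x : \bar R :=
  ereal_sup [set ((t.2 * #|` window t.1.1 t.1.2|%:R `^ (q^-1 - p^-1)
                   * #|` [fset j in window t.1.1 t.1.2 | t.2 < `|x j|]|%:R
                     `^ p^-1)%:E)
            | t in [set t : int * nat * R | 0 < t.2]].

Definition morrey p q : set (int -> K) :=
  [set x | (morrey_norm p q x < +oo)%E].

Definition weak_morrey p q : set (int -> K) :=
  [set x | (weak_morrey_norm p q x < +oo)%E].

End spaces.

Arguments morrey {R} K p q.
Arguments weak_morrey {R} K p q.

(* Main.v *)
(** The converse inclusion [morrey p1 q `<=` weak_morrey p2 q] always holds when
    [p2 <= p1]: Chebyshev's inequality bounds the weak norm of exponent [p1] by
    the strong one, and the weak norm is nondecreasing in the exponent because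
    [W^(1/q - 1/p) n^(1/p) = W^(1/q) (n/W)^(1/p)] with [n/W <= 1]. So an element
    of the difference rules out [p2 <= p1]. *)
Require Import Defs.
From mathcomp Require Import all_boot all_order all_algebra finmap.
From mathcomp Require Import all_classical all_reals all_analysis.
Import Order.TTheory GRing.Theory Num.Theory.
Local Open Scope classical_set_scope.
Local Open Scope ring_scope.

(** Each [j] with [c < f j] contributes at least the [p]-th power of [c]; the other terms are
    nonnegative, even where [f] is negative, since [powR] is. *)
Lemma powR_fset_chebyshev (R : realType) (T : choiceType) (A : {fset T})
    (f : T -> R) (p c : R) : 0 < p -> 0 <= c ->
  c * #|` [fset j in A | c < f j]%fset|%:R `^ p^-1
    <= (\sum_(j <- A) f j `^ p) `^ p^-1.
Proof.
move=> p0 c0.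
have pV0 : 0 <= p^-1 by rewrite invr_ge0 ltW.
(* This puts the whole left side under one [p]-th root, so that only the radicands remain to be
   compared. *)
have -> : c = (c `^ p) `^ p^-1 by rewrite -powRrM divff ?gt_eqF// powRr1.
rewrite -powRM ?powR_ge0// -powRrM divff ?gt_eqF// powRr1//.
apply: ge0_ler_powR => //; rewrite ?nnegrE ?mulr_ge0 ?powR_ge0 ?ler0n//.
  by apply: sumr_ge0 => j _; exact: powR_ge0.
rewrite card_fset_sum1 natr_sum mulr_sumr big_fset /= big_mkcond /=.
apply: ler_sum => j _; case: ifPn => [cj|_]; last exact: powR_ge0.
rewrite mulr1; apply: ge0_ler_powR; rewrite ?nnegrE ?(ltW p0)// ?(ltW cj)//.
exact: le_trans c0 (ltW cj).
Qed.

Lemma powR_density_le (R : realType) (p1 p2 r : R) (n W : nat) :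
  0 < p2 -> p2 <= p1 -> (n <= W)%N ->
  W%:R `^ (r - p2^-1) * n%:R `^ p2^-1 <= W%:R `^ (r - p1^-1) * n%:R `^ p1^-1.
Proof.
move=> p20 p21 nW; have p10 : 0 < p1 by exact: lt_le_trans p21.
(* For [n = 0] both sides vanish, the exponents being nonzero; otherwise [W] is positive and can be
   divided by. *)
case: (posnP n) => [->|n0].
  by rewrite !powR0 ?mulr0// ?invr_eq0 gt_eqF.
have W0 : 0 < W%:R :> R by rewrite ltr0n (leq_trans n0).
have density s : W%:R `^ (r - s) * n%:R `^ s = W%:R `^ r * (n%:R / W%:R) `^ s.
  rewrite powRB; last by rewrite (gt_eqF W0) implybT.
  rewrite powRM ?invr_ge0 ?ler0n// -[W%:R^-1]powR_inv1 ?ler0n// -powRrM.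
  by rewrite mulN1r powRN mulrAC mulrA.
rewrite !density ler_wpM2l ?powR_ge0//.
(* For a base in (0, 1] powers are nonincreasing in the exponent, and inversion reverses
   [p2 <= p1]. *)
apply: ger_powR; last by rewrite lef_pV2.
by rewrite ler_pdivrMr ?mul1r ?ler_nat ?nW ?divr_gt0 ?(ltr0n R n).
Qed.

Lemma weak_morrey_norm_le_morrey_norm (R : realType) (K : normedZmodType R)
    (p q : R) (x : int -> K) : 0 < p ->
  (weak_morrey_norm p q x <= morrey_norm p q x)%E.
Proof.
move=> p0; apply: ge_ereal_sup => _ [[mN c] /= c0 <-].
(* Whatever the threshold [c], the same window serves in the strong supremum. *)
apply: le_trans (ereal_sup_ubound _); last by exists mN.
rewrite lee_fin -mulrA mulrCA ler_wpM2l ?powR_ge0//.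
exact: powR_fset_chebyshev (fun j => `|x j|) _ _ p0 (ltW c0).
Qed.

Lemma le_weak_morrey_norm (R : realType) (K : normedZmodType R)
    (p1 p2 q : R) (x : int -> K) : 0 < p2 -> p2 <= p1 ->
  (weak_morrey_norm p2 q x <= weak_morrey_norm p1 q x)%E.
Proof.
move=> p20 p21; apply: ge_ereal_sup => _ [t /= t0 <-].
apply: le_trans (ereal_sup_ubound _); last by exists t.
rewrite lee_fin -!mulrA ler_pM2l//; apply: powR_density_le => //.
by apply: fsubset_leq_card; exact: fset_sub.
Qed.

Theorem theorem3p5 (R : realType) (k : scalar_kind) (p1 p2 q : R)
  (hp1 : 1 <= p1) (hp1q : p1 <= q) (hp2 : 1 <= p2) (hp2q : p2 <= q)
  (hincl : weak_morrey (scalars R k) p2 q `<=` morrey (scalars R k) p1 q)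
  (hproper :
    morrey (scalars R k) p1 q `\` weak_morrey (scalars R k) p2 q !=set0) :
  p1 < p2.
Proof.
rewrite ltNge; apply/negP => p21.
have [x [xp1 xp2]] := hproper; apply: xp2.
have p20 : 0 < p2 by exact: lt_le_trans hp2.
have p10 : 0 < p1 by exact: lt_le_trans hp1.
apply: le_lt_trans xp1.
apply: le_trans (le_weak_morrey_norm _ _ _ _ _ _ p20 p21) _.
exact: weak_morrey_norm_le_morrey_norm.
Qed.
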